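(* The equation $$r\sin\left(\frac{3r+3}{2r+4}\pi\right)+2\sin\left(\frac{3r}{2r+4}\pi\right)\cos\left(\frac{3}{2r+4}\pi\right)=0$$ has a unique solution $r=r_0$ in the interval $\frac32<r<2$, and the Fuss-Catalan distribution $\mu(2,r)$ is unimodal for all $1<r<r_0$.
   Context: Fuss-Catalan distributions: for real $p,r$ put $A_0(p,r)=1$ and $A_k(p,r)=\frac{r}{k!}\prod_{i=1}^{k-1}(kp+r-i)$ for $k\ge 1$. For $p\ge 1$, $0<r\le p$, it is known that there is a unique compactly supported Borel probability measure $\mu(p,r)$ on $\mathbb{R}$ with $\int x^k\,\mu(p,r)(dx)=A_k(p,r)$ for all $k\ge 0$. It is the Fuss-Catalan distribution. A measure $\rho$ on $\mathbb{R}$ is unimodal if there are $a\in\mathbb{R}$ (the mode), $c\ge 0$ and a function $f\ge 0$, non-decreasing on $(-\infty,a)$ and non-increasing on $(a,\infty)$, with $\rho(dx)=c\,\delta_a(dx)+f(x)\,dx$. *)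

(* Defs.v *)
From HB Require Import structures.
From mathcomp Require Import all_boot all_order all_algebra.
From mathcomp Require Import all_classical all_reals all_analysis.

Set Implicit Arguments.
Unset Strict Implicit.
Unset Printing Implicit Defensive.

Import Order.TTheory GRing.Theory Num.Theory.
Import numFieldNormedType.Exports.

Local Open Scope classical_set_scope.
Local Open Scope ring_scope.

(* The case k = 0 is separate: the closed formula would give r instead of 1. *)
Definition fuss_catalan_number (R : realType) (p r : R) (k : nat) : R :=
  if k is 0%N then 1
  else r / k`!%:R * \prod_(1 <= i < k) (k%:R * p + r - i%:R).

Definition compactly_supported (R : realType)
    (mu : {measure set (measurableTypeR R) -> \bar R}) : Prop :=
  exists2 K : set R, compact K & mu (~` K) = 0%E.

(* For 1 <= p and 0 < r <= p there is exactly one such mu; it is the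
   Fuss-Catalan distribution mu(p, r). *)
Definition is_fuss_catalan (R : realType) (p r : R)
    (mu : probability (measurableTypeR R) R) : Prop :=
  compactly_supported mu /\
  forall k : nat,
    (\int[mu]_x (x ^+ k)%:E = (fuss_catalan_number p r k)%:E)%E.

(* No measurability is assumed of f: it follows from the two monotonicity
   conditions. *)
Definition unimodal (R : realType)
    (rho : {measure set (measurableTypeR R) -> \bar R}) : Prop :=
  exists (a c : R) (f : R -> R),
    [/\ 0 <= c,
        forall x, 0 <= f x,
        {in `]-oo, a[ &, {homo f : x y / x <= y}},
        {in `]a, +oo[ &, {homo f : x y /~ x <= y}} &
        forall A : set (measurableTypeR R), measurable A ->
          rho A = (c%:E * \d_a A +
                   \int[lebesgue_measure]_(x in A) (f x)%:E)%E].

(* Main.v *)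
(** Writing x = 4 cos(phi)^2, the law mu(2, r) has density proportional to
    q(x) = sin(r phi) (2 cos phi)^(r-2) on ]0, 4[. An explicit primitive of
    (k+1)(k+1+r) x^(k+1) q - (2k+r)(2k+r+1) x^k q vanishing at 0 and 4 shows
    that the moments of q obey the recurrence of A_k(2, r); since compactly
    supported measures are determined by their moments, mu(2, r) is q up to
    normalisation. The density blows up at 0, and q'(x) is a negative multiple
    of h(phi) = (r-1) cos((r+1) phi) + cos((r-1) phi), so mu(2, r) is unimodal with
    mode 0 as soon as h > 0 on ]0, pi/2[. At t = 3 pi / (2r+4), h and h' are
    a negative and a positive multiple, respectively, of the increasing
    function K(r) = r + 2 cos(2t), the left-hand side of the equation is
    - cos(t) K(r), and h > 0 on ]0, pi/2[ whenever K(r) < 0. *)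

Require Import Defs.
From HB Require Import structures.
From mathcomp Require Import all_boot all_order all_algebra.
From mathcomp Require Import all_classical all_reals all_analysis.
From mathcomp Require Import measurable_realfun ring lra.

Set Implicit Arguments.
Unset Strict Implicit.
Unset Printing Implicit Defensive.

Import Order.TTheory GRing.Theory Num.Theory.
Import numFieldNormedType.Exports.

Local Open Scope classical_set_scope.
Local Open Scope ring_scope.

(** * Trigonometry of the equation and its unique root *)

Section trigonometry.
Context {R : realType}.
Implicit Types r x y : R.

Lemma cos_3pihalf x y : x + y = 3 / 2 * pi -> cos x = - sin y.
Proof.
move=> /(canRL (addrK _)) ->.
rewrite (_ : _ - y = pi - y + pi / 2); last by field.
by rewrite cosDpihalf addrC sinDpi opprK sinN.
Qed.

Lemma sin_3pihalf x y : x + y = 3 / 2 * pi -> sin x = - cos y.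
Proof.
move=> /(canRL (addrK _)) ->.
rewrite (_ : _ - y = pi - y + pi / 2); last by field.
by rewrite sinDpihalf addrC cosDpi cosN.
Qed.

Definition mode_angle r : R := 3 / (2 * r + 4) * pi.

(* At [phi = mode_angle r], both h(phi) = (r-1)cos((r+1)phi) + cos((r-1)phi)
   and its derivative are multiples of [mode_gap r]: the root of [mode_gap] is
   where h acquires a double zero. *)
Definition mode_gap r : R := r + 2 * cos (2 * mode_angle r).

(** With t the angle, the pairs (r+1)t and t, rt and 2t, (r-1)t and 3t each add up to 3 pi / 2, so
    the two reflection lemmas above turn every multiple of t involving r into t, 2t or 3t. *)
Lemma mode_angle_sum r : -2 < r -> (r + 2) * mode_angle r = 3 / 2 * pi.
Proof. by move=> r2; rewrite /mode_angle; field; lra. Qed.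

(** The two sines are those of (r+1)t and rt, which reflect to - cos t and - cos (2t); the factor -
    cos t then comes out. *)
Lemma mode_equation r : -2 < r ->
  r * sin ((3 * r + 3) / (2 * r + 4) * pi)
    + 2 * sin (3 * r / (2 * r + 4) * pi) * cos (3 / (2 * r + 4) * pi) =
  - cos (mode_angle r) * mode_gap r.
Proof.
move=> r2; have rth := mode_angle_sum r2.
rewrite (@sin_3pihalf _ (mode_angle r)); last by rewrite -rth /mode_angle;
  field; lra.
rewrite (@sin_3pihalf _ (2 * mode_angle r)); last first.
  by rewrite -rth /mode_angle; field; lra.
by rewrite -/(mode_angle r) /mode_gap; ring.
Qed.

Lemma mode_angle_itv r : 1 < r < 2 -> pi / 4 < mode_angle r < pi / 2.
Proof.
move=> /andP[r1 r2]; have pi0 := @pi_gt0 R.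
have := @mode_angle_sum r ltac:(lra).
set t := mode_angle r => e.
have r20 : 0 < r + 2 by lra.
by rewrite -(ltr_pM2l r20) -[t < _](ltr_pM2l r20) e; apply/andP; split; nra.
Qed.

Lemma cos_mode_angle_gt0 r : 1 < r < 2 -> 0 < cos (mode_angle r).
Proof.
move=> /mode_angle_itv/andP[h1 h2]; apply: cos_gt0_pihalf.
by have pi0 := @pi_gt0 R; apply/andP; split; lra.
Qed.

(** The angle 2t = 3 pi / (r + 2) decreases in r and stays in [0, pi], where cos decreases, so both
    summands increase. *)
Lemma mode_gap_increasing x y : 1 <= x -> x < y -> y <= 2 ->
  mode_gap x < mode_gap y.
Proof.
move=> x1 xy y2; have pi0 := @pi_gt0 R.
have x20 : 0 < x + 2 by lra.
have y20 : 0 < y + 2 by lra.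
have ex : (x + 2) * (2 * mode_angle x) = 3 * pi.
  by rewrite mulrCA mode_angle_sum; [field|lra].
have ey : (y + 2) * (2 * mode_angle y) = 3 * pi.
  by rewrite mulrCA mode_angle_sum; [field|lra].
have ax0 : 0 < 2 * mode_angle x by rewrite -(ltr_pM2l x20) ex; lra.
have ay0 : 0 < 2 * mode_angle y by rewrite -(ltr_pM2l y20) ey; lra.
have axy : 2 * mode_angle y < 2 * mode_angle x.
  by rewrite -(ltr_pM2l y20) ey -ex ltr_pM2r //; lra.
have axpi : 2 * mode_angle x <= pi by rewrite -(ler_pM2l x20) ex; nra.
by rewrite /mode_gap ltrD // ltr_pM2l // ltr_cos // in_itv /=;
  apply/andP; split; lra.
Qed.

Lemma continuous_mode_gap x : -2 < x -> {for x, continuous mode_gap}.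
Proof.
move=> x2; apply: differentiable_continuous; apply/derivable1_diffP.
have nz : 2 * x + 4 != 0 by lra.
by rewrite /mode_gap /mode_angle; apply: ex_derive.
Qed.

(** The triple-angle formula at pi / 6 gives c (4 c^2 - 3) = 0 with c > 0. The bound 3/4 is what
    makes [mode_gap] negative at 3/2. *)
Lemma cos_pi6_gt : 3 / 4 < cos (pi / 6 : R).
Proof.
have pi0 := @pi_gt0 R.
have c0 : 0 < cos (pi / 6 : R) by apply: cos_gt0_pihalf; apply/andP; split; lra.
have := @cos_pihalf R; rewrite (_ : pi / 2 = pi / 6 *+ 2 + pi / 6);
  last by field.
rewrite cosD cos_mulr2n sin_mulr2n.
have := sin2cos2 (pi / 6 : R).
move: c0; set c := cos _; set s := sin _ => c0 e1 e2.
have : c * (4 * c ^+ 2 - 3) = 0 by rewrite -[RHS]e2; ring: e1.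
by move=> /eqP; rewrite mulf_eq0 gt_eqF //= => /eqP ?; nra.
Qed.

Lemma mode_gap_root : exists r0 : R, 3 / 2 < r0 < 2 /\ mode_gap r0 = 0.
Proof.
have pi0 := @pi_gt0 R.
have lo : mode_gap (3 / 2) < 0.
  rewrite /mode_gap.
  (* At r = 3/2 the angle 2t is 6 pi / 7 > 5 pi / 6, so 2 cos (2t) < -3/2. At r = 2 it is 3 pi / 4 <
     pi, so 2 cos (2t) > -2. *)
  have : cos (2 * mode_angle (3 / 2)) < cos (pi - pi / 6).
    have e := @mode_angle_sum (3 / 2) ltac:(lra).
    by rewrite ltr_cos ?in_itv /=; [nra|apply/andP; split; nra..].
  have := cos_pi6_gt; rewrite [cos (pi - _)]cosB cospi sinpi.
  by move=> ? ?; lra.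
have hi : 0 < mode_gap 2.
  rewrite /mode_gap.
  have : cos pi < cos (2 * mode_angle (2:R)).
    have e := @mode_angle_sum 2 ltac:(lra).
    by rewrite ltr_cos ?in_itv /=; [nra|apply/andP; split; nra..].
  by rewrite cospi => ?; lra.
have [||c] := @IVT R mode_gap (3 / 2) 2 0 ltac:(lra).
- apply: continuous_in_subspaceT => x; rewrite inE /= in_itv /= => /andP[? _].
  by apply: continuous_mode_gap; lra.
- by rewrite ge_min le_max (ltW lo) (ltW hi) orbT.
rewrite in_itv /= !le_eqVlt => /andP[/predU1P[<-|c1] /predU1P[->|c2]] c0.
- by lra.
- by move: lo; rewrite c0 ltxx.
- by move: hi; rewrite c0 ltxx.
- by exists c; rewrite c1 c2.
Qed.

End trigonometry.

(** * Positivity of h when the gap is negative *)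

Section mode_inequality.
Context {R : realType}.
Variable r : R.
Hypothesis r12 : 1 < r < 2.

Let h (x : R) := (r - 1) * cos ((r + 1) * x) + cos ((r - 1) * x).
Let H (x : R) := (r + 1) * sin ((r + 1) * x) + sin ((r - 1) * x).

Let dh (x : R) : is_derive x 1 h (- (r - 1) * H x).
Proof. by apply: is_derive_eq; rewrite /H /GRing.scale /=; ring. Qed.

Let dH (x : R) : is_derive x 1 H
  ((r + 1) ^+ 2 * cos ((r + 1) * x) + (r - 1) * cos ((r - 1) * x)).
Proof. by apply: is_derive_eq; rewrite /GRing.scale /=; ring. Qed.

Let MVT_everywhere (f df : R -> R) a b : (forall x : R, is_derive x 1 f (df x))
  ->
  a < b -> exists2 c, a < c < b & f b - f a = df c * (b - a).
Proof.
move=> fdf ab; have cf : {within `[a, b], continuous f}.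
  apply: derivable_within_continuous => x _.
  exact: (@ex_derive _ _ _ _ _ _ _ (fdf x)).
have [c] := MVT ab (fun x _ => fdf x) cf.
by rewrite in_itv /= => cab ->; exists c.
Qed.

(** For d = (r+1)c - pi one has cos ((r+1)c) = - cos d, and c <= pi / 2 gives 0 <= d <= (r-1)c <= pi
    / 2. Hence cos ((r-1)c) <= cos d, and r - 1 <= (r+1)^2 makes the derivative nonpositive. *)
Let H_nincr a b : pi / (r + 1) <= a -> a < b -> b <= pi / 2 -> H b <= H a.
Proof.
have /andP[r1 r2] := r12; have pi0 := @pi_gt0 R.
rewrite ler_pdivrMr; last by lra.
move=> la ab lb; have [c /andP[ac cb]] := MVT_everywhere dH ab.
set d := (r + 1) * c - pi => e.
have dc : (r + 1) * c = d + pi by rewrite /d; ring.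
have d0 : 0 <= d by rewrite /d; nra.
have dle : d <= (r - 1) * c by rewrite /d; nra.
have lepi2 : (r - 1) * c <= pi / 2 by nra.
have cc : cos ((r - 1) * c) <= cos d.
  by rewrite leNgt ltr_cos ?in_itv /=; [rewrite -leNgt|apply/andP; split;
    lra..].
have c0 : 0 <= cos ((r - 1) * c).
  by apply: cos_ge0_pihalf; apply/andP; split; lra.
rewrite -subr_le0 e dc cosDpi pmulr_lle0 ?subr_gt0 //.
by nra.
Qed.

(* [h' = - (r - 1) H] and [h], [H] take the values [- sin t * mode_gap r] and
   [- cos t * mode_gap r] at [t = mode_angle r]; the mean value theorem from
   [t] then suffices, since [H > 0] before [t] and [H <= H t] after it. *)
Lemma mode_inequality (x : R) : mode_gap r < 0 -> 0 < x < pi / 2 ->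
  0 < (r - 1) * cos ((r + 1) * x) + cos ((r - 1) * x).
Proof.
have /andP[r1 r2] := r12; have pi0 := @pi_gt0 R.
rewrite -/(h x) => gap_lt0 /andP[x0 xpi].
have /andP[t1 t2] := mode_angle_itv r12.
have ct0 := cos_mode_angle_gt0 r12.
have tsum := @mode_angle_sum R r ltac:(lra).
set t := mode_angle r in t1 t2 ct0 tsum.
have st : cos t <= sin t.
  rewrite -{1}[t](subrK (pi / 2)) cosDpihalf -sinN opprB.
  rewrite leNgt ltr_sin ?in_itv /=; [rewrite -leNgt; lra|..];
  by apply/andP; split; lra.
have hH : h t = - sin t * mode_gap r /\ H t = - cos t * mode_gap r.
  rewrite /h /H /mode_gap -/t.
  rewrite (@cos_3pihalf _ ((r + 1) * t) t) ?(@sin_3pihalf _ ((r + 1) * t) t);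
    try by rewrite -tsum; ring.
  rewrite (@cos_3pihalf _ ((r - 1) * t) (3 * t)) ?(@sin_3pihalf _ ((r - 1) * t)
    (3 * t));
    try by rewrite -tsum; ring.
  have -> : 3 * t = t *+ 2 + t by ring.
  have -> : 2 * t = t *+ 2 by ring.
  rewrite (cosD (t *+ 2)) (sinD (t *+ 2)) cos_mulr2n sin_mulr2n.
  by have s2 := sin2cos2 t; split; ring: s2.
have [ht Ht] := hH.
have pir : pi / (r + 1) <= t.
  by rewrite ler_pdivrMr; [nra|lra].
have [xt|tx|->] := ltgtP x t; last by rewrite ht; nra.
- have [c /andP[xc ct] e] := MVT_everywhere dh xt.
  have Hc : 0 < H c.
    (* Up to pi / (r+1) both sines in [H] are nonnegative, the second strictly positive; beyond it
       [H c >= H t > 0] by monotonicity. *)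
    have [cle|clt] := leP c (pi / (r + 1)).
      rewrite ler_pdivlMr in cle; last by lra.
      have : 0 <= sin ((r + 1) * c) by apply: sin_ge0_pi; apply/andP; split;
        nra.
      have : 0 < sin ((r - 1) * c) by apply: sin_gt0_pi; apply/andP; split; nra.
      by rewrite /H => ? ?; nra.
    apply: lt_le_trans (H_nincr (ltW clt) ct (ltW t2)).
    by rewrite Ht; nra.
  have : 0 < h t by rewrite ht; nra.
  have : (r - 1) * H c * (t - x) > 0 by rewrite !mulr_gt0 //; lra.
  by lra.
- have [c /andP[tc cx] e] := MVT_everywhere dh tx.
  have Hc : H c <= H t by apply: H_nincr => //; lra.
  have pi4 : x - t <= 1 by have := @pihalf_lt2 R; lra.
  have -> : h x = - sin t * mode_gap r - (r - 1) * H c * (x - t).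
    by rewrite -ht; lra.
  have : (r - 1) * H c * (x - t) <= (r - 1) * H t * (x - t).
    by rewrite ler_wpM2r ?ler_wpM2l //; lra.
  (* It remains to bound - [mode_gap r] times sin t - (r-1)(x-t) cos t from below. This bracket is
     the sum of (1 - (r-1)(x-t)) cos t > 0 and sin t - cos t, which is nonnegative because t > pi /
     4. *)
  have q1 : (r - 1) * (x - t) < 1 by nra.
  have : 0 < (1 - (r - 1) * (x - t)) * (cos t * - mode_gap r).
    by rewrite !mulr_gt0 //; lra.
  have : 0 <= (sin t - cos t) * - mode_gap r by rewrite mulr_ge0 //; lra.
  by rewrite Ht => ? ? ?; lra.
Qed.

End mode_inequality.

(** * The change of variable x = 4 cos(phi)^2 *)

Section density.
Context {R : realType}.
Implicit Types r x : R.

(* The solution phi of x = 4 cos(phi)^2 in [0, pi/2[, for 0 < x <= 4. *)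
Definition fc_angle x : R := atan (Num.sqrt (4 - x) / Num.sqrt x).

Lemma continuous_fc_angle x : 0 < x -> {for x, continuous fc_angle}.
Proof.
move=> x0; apply: continuous_comp; last exact: continuous_atan.
apply: continuousM.
  by apply: continuous_comp; [apply: continuousB;
    [exact: cvg_cst|exact: cvg_id]|exact: sqrt_continuous].
by apply: continuousV; [rewrite gt_eqF ?sqrtr_gt0|exact: sqrt_continuous].
Qed.

Lemma fc_angle4 : fc_angle 4 = 0.
Proof. by rewrite /fc_angle subrr sqrtr0 mul0r atan0. Qed.

Lemma fc_angle_itv x : 0 < x < 4 -> 0 < fc_angle x < pi / 2.
Proof.
move=> /andP[x0 x4]; rewrite atan_ltpi2 andbT -atan0 lt_atan //.
by rewrite divr_gt0 // sqrtr_gt0 ?subr_gt0.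
Qed.

Lemma cos_fc_angle x : 0 < x <= 4 -> cos (fc_angle x) = Num.sqrt x / 2.
Proof.
move=> /andP[x0 x4]; have y0 : 0 < Num.sqrt x by rewrite sqrtr_gt0.
have ey := sqr_sqrtr (ltW x0).
have ew : Num.sqrt (4 - x) ^+ 2 = 4 - x by rewrite sqr_sqrtr //; lra.
rewrite cos_atan exprMn exprVn ew ey.
have -> : 1 + (4 - x) / x = (2 / Num.sqrt x) ^+ 2.
  by rewrite exprMn exprVn ey; field; lra.
by rewrite sqrtr_sqr gtr0_norm ?divr_gt0 // invf_div.
Qed.

Lemma sin_fc_angle x : 0 < x <= 4 -> sin (fc_angle x) = Num.sqrt (4 - x) / 2.
Proof.
move=> x04; have /andP[x0 x4] := x04.
have y0 : 0 < Num.sqrt x by rewrite sqrtr_gt0.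
have := atanK (Num.sqrt (4 - x) / Num.sqrt x).
rewrite -/(fc_angle x) /tan cos_fc_angle // => /(canRL (divfK _)) ->.
  by field; lra.
by lra.
Qed.

Lemma is_derive_sqrt4B x : x < 4 ->
  is_derive x 1 (fun z : R => Num.sqrt (4 - z)) (- (2 * Num.sqrt (4 - x))^-1).
Proof.
move=> x4; have d4 : is_derive (4 - x) 1 (@Num.sqrt R) (2 * Num.sqrt (4 -
  x))^-1.
  by apply: is_derive1_sqrt; lra.
have -> : (fun z : R => Num.sqrt (4 - z)) = @Num.sqrt R \o (fun z : R =>
  4 - z) by [].
by apply: is_derive_eq; rewrite /GRing.scale /=; ring.
Qed.

Lemma is_derive_fc_angle x : 0 < x < 4 ->
  is_derive x 1 fc_angle (- (2 * Num.sqrt x * Num.sqrt (4 - x))^-1).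
Proof.
move=> /andP[x0 x4]; have y0 : 0 < Num.sqrt x by rewrite sqrtr_gt0.
have w0 : 0 < Num.sqrt (4 - x) by rewrite sqrtr_gt0 subr_gt0.
have ey := sqr_sqrtr (ltW x0).
have ew : Num.sqrt (4 - x) ^+ 2 = 4 - x by rewrite sqr_sqrtr //; lra.
have dy : is_derive x 1 (@Num.sqrt R) (2 * Num.sqrt x)^-1
  by exact: is_derive1_sqrt.
have dw := @is_derive_sqrt4B x x4.
have dyV : is_derive x 1 (fun z : R => (Num.sqrt z)^-1)
    (- (Num.sqrt x) ^- 2 * (2 * Num.sqrt x)^-1).
  by apply: is_derive_eq; [apply: is_deriveV; rewrite gt_eqF|].
have dq : is_derive x 1 (fun z : R => Num.sqrt (4 - z) / Num.sqrt z)
  (- (2 * Num.sqrt (4 - x))^-1 / Num.sqrt x +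
   Num.sqrt (4 - x) * (- (Num.sqrt x) ^- 2 * (2 * Num.sqrt x)^-1)).
  apply: is_derive_eq; rewrite /GRing.scale /=; ring.
have -> : fc_angle = @atan R \o (fun z : R =>
  Num.sqrt (4 - z) / Num.sqrt z) by [].
apply: is_derive_eq; rewrite /GRing.scale /=.
have -> : 1 + (Num.sqrt (4 - x) / Num.sqrt x) ^+ 2 = 4 / (Num.sqrt x) ^+ 2.
  by rewrite exprMn exprVn ew ey; field; lra.
move: ew ey y0 w0; set y := Num.sqrt x; set w := Num.sqrt (4 - _).
move=> ew ey y0 w0.
(* Isolates y^2 + w^2 = 4, which cancels the 4 coming from 1 + tan^2 = 4 / y^2. *)
have -> : - (2 * w)^-1 / y + w * (- y ^- 2 * (2 * y)^-1) =
   - (y ^+ 2 + w ^+ 2) / (2 * w * y ^+ 3).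
  by field; rewrite !gt_eqF.
have -> : y ^+ 2 + w ^+ 2 = 4 by rewrite ey ew; ring.
by field; rewrite !gt_eqF.
Qed.

End density.

(** * Derivatives of the density and of the moment primitive *)

Section density_derivative.
Context {R : realType}.
Variable r : R.
Implicit Types x : R.

(* With x = y^2 and y = 2 cos(phi), this is y^(r-2) sin(r phi), that is,
   pi times the density of mu(2, r). *)
Definition fc_density x : R := x `^ (r / 2 - 1) * sin (r * fc_angle x).

(* A combination of y^(m+1) sin(phi) cos(r phi), y^m sin(r phi) and
   y^(m+2) sin(r phi), where x = y^2, y = 2 cos(phi) and m = 2k + r; the
   coefficients are those cancelling every cos(r phi) in the derivative. *)
Definition fc_primitive k x : R :=
  x ^+ k.+1 * x `^ (r / 2 - 1) *
  ((k%:R + 1 + r / 2) * x * sin (r * fc_angle x)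
   - 2 * (k%:R *+ 2 + r + 1) * sin (r * fc_angle x)
   - r / 2 * (Num.sqrt x * Num.sqrt (4 - x)) * cos (r * fc_angle x)).

Lemma is_derive_powR_density x : 0 < x ->
  is_derive x 1 (fun z => z `^ (r / 2 - 1))
    ((r / 2 - 1) * x `^ (r / 2 - 1) / x).
Proof.
move=> x0; apply: is_derive_eq; first exact: is_derive1_powR.
by rewrite -mulrA; congr (_ * _);
  rewrite powRB ?powRr1 ?(ltW x0) // (gt_eqF x0) implybT.
Qed.

(** Substituting y = 2 cos(phi) and w = 2 sin(phi), the derivative contains r cos(phi) cos(r phi) +
    (2-r) sin(phi) sin(r phi), which is h(phi) by the addition formulas. *)
Lemma is_derive_fc_density x : 0 < x < 4 ->
  is_derive x 1 fc_density
   (- (x `^ (r / 2 - 1) / (x * Num.sqrt (4 - x))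
       * ((r - 1) * cos ((r + 1) * fc_angle x) + cos ((r - 1) * fc_angle x)))).
Proof.
move=> x04; have /andP[x0 x4] := x04.
have dphi := is_derive_fc_angle x04.
have dP := is_derive_powR_density x0.
have cphi : cos (fc_angle x) = Num.sqrt x / 2 by apply: cos_fc_angle; lra.
have sphi : sin (fc_angle x) = Num.sqrt (4 - x) / 2 by apply: sin_fc_angle; lra.
have y0 : 0 < Num.sqrt x by rewrite sqrtr_gt0.
have w0 : 0 < Num.sqrt (4 - x) by rewrite sqrtr_gt0 subr_gt0.
have ey := sqr_sqrtr (ltW x0).
have ds : is_derive x 1 (fun z => sin (r * fc_angle z))
   (cos (r * fc_angle x) * (r * - (2 * Num.sqrt x * Num.sqrt (4 - x))^-1)).
  have -> : (fun z => sin (r * fc_angle z)) = @sin R \o (fun z =>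
    r * fc_angle z) by [].
  by apply: is_derive_eq; rewrite /GRing.scale /=; ring.
apply: is_derive_eq; rewrite /GRing.scale /=.
rewrite (mulrDl r 1) (mulrBl (fc_angle x) r 1) mul1r cosD cosB cphi sphi.
move: y0 w0 ey; set y := Num.sqrt x; set w := Num.sqrt (4 - _) => y0 w0 ey.
move: (x `^ _) => P; rewrite -ey; field.
by rewrite !gt_eqF.
Qed.

Lemma is_derive_fc_primitive k x : 0 < x < 4 ->
  is_derive x 1 (fc_primitive k)
   ((k%:R + 1) * (k%:R + 1 + r) * (x ^+ k.+1 * fc_density x)
    - (k%:R *+ 2 + r) * (k%:R *+ 2 + r + 1) * (x ^+ k * fc_density x)).
Proof.
move=> x04; have /andP[x0 x4] := x04.
have dphi := is_derive_fc_angle x04.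
have dP := is_derive_powR_density x0.
have y0 : 0 < Num.sqrt x by rewrite sqrtr_gt0.
have w0 : 0 < Num.sqrt (4 - x) by rewrite sqrtr_gt0 subr_gt0.
have ey := sqr_sqrtr (ltW x0).
have ew : Num.sqrt (4 - x) ^+ 2 = 4 - x by rewrite sqr_sqrtr //; lra.
have ds : is_derive x 1 (fun z => sin (r * fc_angle z))
   (cos (r * fc_angle x) * (r * - (2 * Num.sqrt x * Num.sqrt (4 - x))^-1)).
  have -> : (fun z => sin (r * fc_angle z)) = @sin R \o (fun z =>
    r * fc_angle z) by [].
  by apply: is_derive_eq; rewrite /GRing.scale /=; ring.
have dc : is_derive x 1 (fun z => cos (r * fc_angle z))
   (- sin (r * fc_angle x) * (r * - (2 * Num.sqrt x * Num.sqrt (4 - x))^-1)).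
  have -> : (fun z => cos (r * fc_angle z)) = @cos R \o (fun z =>
    r * fc_angle z) by [].
  by apply: is_derive_eq; rewrite /GRing.scale /=; ring.
have dy : is_derive x 1 (@Num.sqrt R) (2 * Num.sqrt x)^-1
  by exact: is_derive1_sqrt.
have dw := @is_derive_sqrt4B R x x4.
have dX : is_derive x 1 (fun z : R => z ^+ k.+1) ((k%:R + 1) * x ^+ k).
  have -> : (fun z : R => z ^+ k.+1) = id ^+ k.+1 by apply/funext => z;
    rewrite fctE.
  by apply: is_derive_eq; rewrite -natr1 /GRing.scale /=; ring.
rewrite /fc_primitive; apply: is_derive_eq; rewrite /GRing.scale /=.
rewrite /fc_density.
move: ew ey y0 w0; set y := Num.sqrt x; set w := Num.sqrt (4 - _).
move=> ew ey y0 w0.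
(* With the transcendental values abstracted, a rational identity in y and w modulo w^2 = 4 - y^2
   remains. *)
move: (cos _) (sin _) (x `^ _) => c s P.
have ew' : w ^+ 2 = 4 - y ^+ 2 by rewrite ew ey.
rewrite exprS; move: (k%:R) (x ^+ k) => K X; rewrite -ey.
by field: ew'; rewrite !gt_eqF.
Qed.

End density_derivative.

(** * Continuity, sign and boundary behaviour at 0 and 4 *)

Section density_moments.
Context {R : realType}.
Variable r : R.
Hypothesis r02 : 0 < r < 2.
Implicit Types x : R.

Let r_gt0 : 0 < r. Proof. by case/andP: r02. Qed.

Let continuous_powR_density x : 0 < x ->
  {for x, continuous (fun z : R => z `^ (r / 2 - 1))}.
Proof.
move=> x0; apply: differentiable_continuous; apply/derivable1_diffP.
by apply: ex_derive; exact: is_derive1_powR.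
Qed.

Lemma continuous_sin_fc x : 0 < x -> {for x, continuous (fun z : R =>
  sin (r * fc_angle z))}.
Proof.
move=> x0; apply: continuous_comp; last exact: continuous_sin.
by apply: continuousM; [exact: cvg_cst|exact: continuous_fc_angle].
Qed.

Lemma continuous_fc_density x : 0 < x -> {for x, continuous (fc_density r)}.
Proof.
move=> x0; apply: continuousM; first exact: continuous_powR_density.
exact: continuous_sin_fc.
Qed.

Lemma continuous_moment_density (k : nat) x : 0 < x ->
  {for x, continuous (fun z : R => z ^+ k * fc_density r z)}.
Proof.
move=> x0; apply: continuousM; last exact: continuous_fc_density.
exact: exprn_continuous.
Qed.

Lemma continuous_fc_primitive k x : 0 < x ->
  {for x, continuous (fc_primitive r k)}.
Proof.
move=> x0.
have cs := continuous_sin_fc x0.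
have cc : {for x, continuous (fun z : R => cos (r * fc_angle z))}.
  apply: continuous_comp; last exact: continuous_cos.
  by apply: continuousM; [exact: cvg_cst|exact: continuous_fc_angle].
apply: continuousM.
  by apply: continuousM; [exact: exprn_continuous|exact:
    continuous_powR_density].
apply: continuousB.
  apply: continuousB; apply: continuousM => //; last exact: cvg_cst.
  by apply: continuousM; [exact: cvg_cst|exact: cvg_id].
apply: continuousM => //; apply: continuousM; first exact: cvg_cst.
apply: continuousM; first exact: sqrt_continuous.
apply: continuous_comp; last exact: sqrt_continuous.
by apply: continuousB; [exact: cvg_cst|exact: cvg_id].
Qed.

Lemma fc_density_gt0 x : 0 < x < 4 -> 0 < fc_density r x.
Proof.
move=> x04; have /andP[x0 x4] := x04; have /andP[r0 r2] := r02.
have /andP[p0 p2] := fc_angle_itv x04.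
rewrite mulr_gt0 ?powR_gt0 //; apply: sin_gt0_pi.
by apply/andP; split; nra.
Qed.

Lemma fc_density4 : fc_density r 4 = 0.
Proof. by rewrite /fc_density fc_angle4 mulr0 sin0 mulr0. Qed.

Lemma fc_density_ge0 x : 0 < x <= 4 -> 0 <= fc_density r x.
Proof.
move=> /andP[x0]; rewrite le_eqVlt => /predU1P[->|x4];
  first by rewrite fc_density4.
by rewrite ltW // fc_density_gt0 // x0.
Qed.

Lemma fc_primitive4 k : fc_primitive r k 4 = 0.
Proof. by rewrite /fc_primitive fc_angle4 mulr0 sin0 cos0 subrr sqrtr0;
  ring. Qed.

(** The bracket is bounded and the prefactor is x^k x^(r/2), so for r > 0 the boundary term at 0
    vanishes in the limit. *)
Lemma norm_fc_primitive_le k x : 0 < x <= 1 ->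
  `|fc_primitive r k x| <= (5 * k%:R + 4 * r + 3) * x `^ (r / 2).
Proof.
move=> /andP[x0 x1]; rewrite /fc_primitive exprS.
have -> : x `^ (r / 2) = x * x `^ (r / 2 - 1).
  by rewrite -{2}[x]powRr1 ?ltW // -powRD ?(gt_eqF x0) ?implybT //;
    congr (_ `^ _); ring.
have P0 : 0 < x `^ (r / 2 - 1) by rewrite powR_gt0.
rewrite -!mulrA [leRHS]mulrCA normrM ger0_norm ?(ltW x0) //.
rewrite ler_pM2l // [leRHS]mulrC normrM ger0_norm ?exprn_ge0 ?(ltW x0) //.
rewrite -[leRHS]mul1r ler_pM ?exprn_ile1 ?exprn_ge0 ?(ltW x0) //.
rewrite normrM ger0_norm ?(ltW P0) // ler_pM2l //.
set s := sin _; set c := cos _.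
have s1 : `|s| <= 1 by exact: sin_max.
have c1 : `|c| <= 1 by exact: cos_max.
have y1 : Num.sqrt x <= 1 by rewrite -sqrtr1 ler_sqrt.
have w1 : Num.sqrt (4 - x) <= 2.
  rewrite -[leRHS]ger0_norm // -sqrtr_sqr ler_sqrt ?sqr_ge0 //; lra.
have y0 : 0 <= Num.sqrt x by exact: sqrtr_ge0.
have w0 : 0 <= Num.sqrt (4 - x) by exact: sqrtr_ge0.
have yw : Num.sqrt x * Num.sqrt (4 - x) <= 2 by nra.
have yw0 : 0 <= Num.sqrt x * Num.sqrt (4 - x) by rewrite mulr_ge0.
have k0 : 0 <= k%:R :> R by [].
have le1 (a b d : R) : 0 <= a -> a <= d -> `|b| <= 1 -> `|a * b| <= d.
  move=> a0 ad b1; rewrite normrM ger0_norm // -[d]mulr1.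
  by rewrite ler_pM.
have A1 : `|(k%:R + 1 + r / 2) * x * s| <= k%:R + 1 + r / 2.
  by apply: le1 => //; have := r_gt0; nra.
have A2 : `|2 * (k%:R *+ 2 + r + 1) * s| <= 2 * (k%:R *+ 2 + r + 1).
  by apply: le1 => //; have := r_gt0; lra.
have A3 : `|r / 2 * (Num.sqrt x * Num.sqrt (4 - x)) * c| <= r.
  by apply: le1 => //; have := r_gt0; nra.
rewrite !mulrA in A1 A2 A3 *.
(* The three bounds add up to 5k + 3 + 7r/2, and 7r/2 <= 4r. *)
apply: le_trans (ler_normB _ _) _;
  apply: le_trans (lerD (ler_normB _ _) (lexx _)) _.
have := r_gt0; lra.
Qed.

End density_moments.

(** * Moment recurrence and finiteness of the moments *)

Section density_integrals.
Context {R : realType}.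
Variable r : R.
Hypothesis r02 : 0 < r < 2.
Implicit Types x : R.
Notation leb := (@lebesgue_measure R).
Local Open Scope ereal_scope.

Definition fc_moment (D : set R) k := \int[leb]_(x in D) (x ^+ k * fc_density r
  x)%:E.

Let r_gt0 : (0 < r)%R. Proof. by case/andP: r02. Qed.

Lemma within_continuous_gt0 (f : R -> R) (D : set R) : D `<=` `]0%R, +oo[ ->
  (forall x, (0 < x)%R -> {for x, continuous f}) -> {within D, continuous f}.
Proof.
move=> D0 cf; apply: continuous_in_subspaceT => x /set_mem /D0 /=.
by rewrite in_itv /= andbT; exact: cf.
Qed.

Lemma measurable_moment_density k (D : set R) : measurable D ->
  D `<=` `]0%R, +oo[ ->
  measurable_fun D (fun x : R => x ^+ k * fc_density r x)%R.
Proof.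
move=> mD D0.
apply: subspace_continuous_measurable_fun => //.
by apply: within_continuous_gt0 => // x; exact: continuous_moment_density.
Qed.

Lemma moment_density_ge0 k x : (0 < x <= 4)%R ->
  0 <= (x ^+ k * fc_density r x)%:E.
Proof.
move=> /andP[x0 x4]; rewrite lee_fin mulr_ge0 ?exprn_ge0 ?(ltW x0) //.
by apply: fc_density_ge0; rewrite ?r02 ?x0.
Qed.

Let sub0y (e : R) : (0 < e)%R -> `[e, 4%R] `<=` `]0%R, +oo[.
Proof.
by move=> e0 x /=; rewrite !in_itv /= andbT => /andP[+ _]; exact: lt_le_trans.
Qed.

Lemma integrable_moment_density k (e : R) : (0 < e)%R ->
  leb.-integrable `[e, 4%R] (EFin \o (fun x => x ^+ k * fc_density r x)%R).
Proof.
move=> e0; apply: continuous_compact_integrable; first exact: segment_compact.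
apply: within_continuous_gt0; first exact: sub0y.
by move=> x; exact: continuous_moment_density.
Qed.

(** The fundamental theorem of calculus for [fc_primitive], which vanishes at 4. The cut-off [e]
    avoids the singular factor x^(r/2-1) at 0. *)
Lemma fc_moment_itv_recurrence k (e : R) : (0 < e < 4)%R ->
  ((k%:R + 1) * (k%:R + 1 + r))%:E * fc_moment `[e, 4%R] k.+1 =
  ((k%:R *+ 2 + r) * (k%:R *+ 2 + r + 1))%:E * fc_moment `[e, 4%R] k
  + (- fc_primitive r k e)%:E.
Proof.
move=> /andP[e0 e4]; set c1 := (X in X%:E * _);
  set c2 := (X in _ = X%:E * _ + _).
pose g k x := (x ^+ k * fc_density r x)%R.
have ig j : leb.-integrable `[e, 4%R] (EFin \o g j)
  by exact: integrable_moment_density.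
have fg j : fc_moment `[e, 4%R] j \is a fin_num.
  by apply: integrable_fin_num => //; exact: ig.
have : \int[leb]_(x in `[e, 4%R]) (c1 * g k.+1 x - c2 * g k x)%:E =
    (fc_primitive r k 4)%:E - (fc_primitive r k e)%:E.
  apply: (@continuous_FTC2 _ _ (fc_primitive r k)) => //.
  - apply: within_continuous_gt0; first exact: sub0y.
    move=> x x0; apply: continuousB; apply: continuousM; try exact: cvg_cst;
    exact: continuous_moment_density.
  - split.
    + move=> x; rewrite in_itv /= => /andP[ex x4].
      have x04 : (0 < x < 4)%R by rewrite x4 (lt_trans e0).
      by have [] := is_derive_fc_primitive r k x04.
    + by apply: cvg_at_right_filter; exact: continuous_fc_primitive.
    + by apply: cvg_at_left_filter; exact: continuous_fc_primitive.
  - move=> x; rewrite in_itv /= => /andP[ex x4].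
    have x04 : (0 < x < 4)%R by rewrite x4 (lt_trans e0).
    by rewrite derive1E; have [_ ->] := is_derive_fc_primitive r k x04.
rewrite fc_primitive4 sub0e.
under eq_integral do rewrite EFinB.
rewrite integralB_EFin //; last 2 first.
- rewrite (_ : EFin \o _ = (fun x => c1%:E * (g k.+1 x)%:E)) //.
  by apply: integrableZl => //; exact: ig.
- rewrite (_ : EFin \o _ = (fun x => c2%:E * (g k x)%:E)) //.
  by apply: integrableZl => //; exact: ig.
under eq_integral do rewrite EFinM.
rewrite integralZl //; last exact: ig.
under [X in _ - X]eq_integral do rewrite EFinM.
rewrite integralZl //; last exact: ig.
rewrite -/(fc_moment _ _) -/(fc_moment _ _).
rewrite -[fc_moment _ k.+1](fineK (fg _)) -[fc_moment _ k](fineK (fg _)).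
by rewrite -!EFinM -EFinB -EFinD => -[] e'; congr EFin; lra.
Qed.

Let F n := `[(n.+1%:R^-1)%R : R, 4%R]%classic.

Let F_pos n : (0 < (n.+1%:R^-1 : R) < 4)%R.
Proof.
rewrite invr_gt0 ltr0n /= (le_lt_trans (_ : _ <= 1)%R) //; last by lra.
by rewrite invf_le1 ?ler1n ?ltr0n.
Qed.

Let F_cover : \bigcup_n F n = `]0%R, 4%R]%classic.
Proof.
apply/seteqP; split => x /=.
  move=> [n _]; rewrite /F /= !in_itv /= => /andP[nx x4].
  by rewrite x4 andbT (lt_le_trans _ nx) //; case/andP: (F_pos n).
rewrite in_itv /= => /andP[x0 x4].
have [n nx] : exists n, (n.+1%:R^-1 <= x)%R.
  exists (Num.truncn x^-1).
  rewrite invf_ple ?posrE ?ltr0n //.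
  by apply: ltW; exact: truncnS_gt.
by exists n => //; rewrite /F /= in_itv /= nx.
Qed.

Let cvg_moment k : fc_moment (F n) k @[n --> \oo] --> fc_moment `]0%R, 4%R] k.
Proof.
rewrite /fc_moment -F_cover; apply: ge0_nondecreasing_set_cvg_integral.
- move=> m n mn; apply/subsetPset; apply: subset_itvr.
  by rewrite bnd_simp lef_pV2 ?posrE ?ltr0n // ler_nat.
- by move=> n; exact: measurable_itv.
- move=> n; apply/measurable_EFinP; apply: measurable_moment_density;
  first exact: measurable_itv.
  by apply: sub0y; case/andP: (F_pos n).
- move=> n x; rewrite /F /= in_itv /= => /andP[nx x4].
  by apply: moment_density_ge0; rewrite x4 (lt_le_trans _ nx) // invr_gt0.
Qed.

Let cvg_primitive k : (- fc_primitive r k (n.+1%:R^-1))%:E @[n --> \oo] --> 0%E.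
Proof.
apply: cvg_EFin; first exact: nearW.
set C := (5 * k%:R + 4 * r + 3)%R.
have cC : (C * n.+1%:R^-1 `^ (r / 2))%R @[n --> \oo] --> 0%R.
  rewrite -(mulr0 C); apply: cvgM; first exact: cvg_cst.
  have /cvg_at_rightP := @powR_cvg0 R (r / 2) ltac:(have := r_gt0; lra).
  by apply; split => [n|]; [rewrite invr_gt0|exact: cvg_harmonic].
have cNC : (- (C * n.+1%:R^-1 `^ (r / 2)))%R @[n --> \oo] --> 0%R.
  by rewrite -oppr0; exact: cvgN.
apply: squeeze_cvgr cNC cC; apply: nearW => n.
rewrite -ler_norml normrN; apply: norm_fc_primitive_le => //.
by rewrite invr_gt0 ltr0n /= invf_le1 ?ler1n ?ltr0n.
Qed.

(** Limit of the truncated recurrence along e = 1/(n+1): the integrals converge monotonically and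
    the boundary term tends to 0. It is stated in the extended reals because finiteness of the
    moments is deduced from it. *)
Lemma fc_moment_recurrence k :
  ((k%:R + 1) * (k%:R + 1 + r))%:E * fc_moment `]0%R, 4%R] k.+1 =
  ((k%:R *+ 2 + r) * (k%:R *+ 2 + r + 1))%:E * fc_moment `]0%R, 4%R] k.
Proof.
set c1 := (X in X%:E * _); set c2 := (X in _ = X%:E * _).
have L : c1%:E * fc_moment (F n) k.+1 @[n --> \oo] -->
  c1%:E * fc_moment `]0%R, 4%R] k.+1.
  exact: cvgeZl.
have := L; under eq_fun do rewrite fc_moment_itv_recurrence //.
rewrite -/c2 => L'.
apply: (cvg_unique _ L') => //.
rewrite -[c2%:E * fc_moment `]0%R, 4%R] k]adde0; apply: cvgeD.
- by rewrite fin_num_adde_defl.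
- exact: cvgeZl.
- exact: cvg_primitive.
Qed.

Lemma fc_moment_ge0 k : 0 <= fc_moment `]0%R, 4%R] k.
Proof.
apply: integral_ge0 => x /=; rewrite in_itv /=; exact: moment_density_ge0.
Qed.

Let fc_moment1_lty : fc_moment `]0%R, 4%R] 1 < +oo.
Proof.
apply: (@le_lt_trans _ _ (\int[leb]_(x in `]0%R, 4%R]) (cst (4 `^ (r /
  2))%R%:E) x)).
  apply: ge0_le_integral => //.
  - by move=> x /=; rewrite in_itv /=; exact: moment_density_ge0.
  - apply/measurable_EFinP; apply: measurable_moment_density => // x /=.
    by rewrite !in_itv /= andbT => /andP[].
  - move=> x /=; rewrite in_itv /= => /andP[x0 x4].
    rewrite lee_fin expr1 /fc_density mulrA.
    rewrite -{1}[x]powRr1 ?(ltW x0) // -powRD ?(gt_eqF x0) ?implybT //.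
    rewrite (_ : 1 + (r / 2 - 1) = r / 2)%R; last by ring.
        apply: (@le_trans _ _ (x `^ (r / 2) * 1)%R).
      by rewrite ler_wpM2l ?powR_ge0 // sin_le1.
    rewrite mulr1; apply: ge0_ler_powR => //; rewrite ?nnegrE //; [|exact: ltW].
    by have := r_gt0; lra.
rewrite integral_cst //= lebesgue_measure_itv /= lte_fin ltr0n /=.
by rewrite -EFinB -EFinM ltry.
Qed.

(** The density is unbounded near 0, but x times it is at most 4^(r/2), so the first moment is
    finite. The recurrence carries this back to the mass, and then forward to all moments. *)
Lemma fc_moment_fin_num k : fc_moment `]0%R, 4%R] k \is a fin_num.
Proof.
have finE j : (fc_moment `]0%R, 4%R] j \is a fin_num) =
  (fc_moment `]0%R, 4%R] j < +oo).
  by rewrite ge0_fin_numE ?fc_moment_ge0.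
elim: k => [|k IH].
  rewrite finE ltNge leye_eq; apply/eqP => e.
  have := fc_moment_recurrence 0; rewrite e gt0_muley; last first.
    by rewrite lte_fin; have := r_gt0; nra.
  by have := fc_moment1_lty; rewrite -finE => /fineK <-; rewrite -EFinM.
have k0 : (0 <= k%:R :> R)%R by [].
rewrite finE ltNge leye_eq; apply/eqP => e.
have := fc_moment_recurrence k; rewrite e gt0_muley; last first.
  by rewrite lte_fin; have := r_gt0; nra.
by rewrite -(fineK IH) -EFinM.
Qed.

End density_integrals.

(** The case k = 0 is checked apart, because [fuss_catalan_number] treats that index separately. *)
Lemma fuss_catalan2_recurrence (R : realType) (r : R) (k : nat) : 0 < r ->
  (k%:R + 1) * (k%:R + 1 + r) * fuss_catalan_number 2 r k.+1 =
  (k%:R *+ 2 + r) * (k%:R *+ 2 + r + 1) * fuss_catalan_number 2 r k.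
Proof.
move=> r0; case: k => [|j]; rewrite /fuss_catalan_number.
  by rewrite big_geq // mul0rn divr1; ring.
have j0 : 0 <= j%:R :> R by [].
set P := \prod_(1 <= i < j.+2) _; set Q := \prod_(1 <= i < j.+1) _.
(* The extra factor is the one of index i = j + 2. Removing the factors i = 1 and i = 2 from the
   extended product and shifting the index by 2 leaves [Q]. *)
have PQ : P * (j.+2%:R + r) = (j.+1%:R *+ 2 + r + 1) * (j.+1%:R *+ 2 + r) * Q.
  have -> : P * (j.+2%:R + r) =
      \prod_(1 <= i < j.+3) (j.+2%:R * 2 + r - i%:R).
    by rewrite [RHS]big_nat_recr //=; congr (_ * _); rewrite -!natr1; ring.
  rewrite big_ltn // big_ltn // mulrA; congr (_ * _ * _);
    first by rewrite -!natr1; ring.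
    by rewrite -!natr1; ring.
  transitivity (\prod_(1 + 2 <= i < j.+3) (j.+2%:R * 2 + r - i%:R));
    first by [].
  rewrite big_addn subn2 /=.
  by apply: eq_bigr => i _; rewrite natrD -!natr1; ring.
rewrite factS natrM invfM.
have f0 : j.+1`!%:R != 0 :> R by rewrite pnatr_eq0 -lt0n fact_gt0.
have j2 : j.+2%:R != 0 :> R by rewrite pnatr_eq0.
transitivity (r / j.+1`!%:R * (P * (j.+2%:R + r))).
  move: f0 j2; rewrite -[j.+2%:R]natr1; move: (j.+1%:R) (_`!%:R) => a b b0 a0.
  by field; rewrite b0 a0.
by rewrite PQ; ring.
Qed.

(** * Monotonicity of the density and its normalisation *)

Section density_monotonicity.
Context {R : realType}.
Variable r : R.
Hypothesis r12 : 1 < r < 2.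
Hypothesis gap_lt0 : mode_gap r < 0.
Notation leb := (@lebesgue_measure R).

Let r02 : 0 < r < 2. Proof. by case/andP: r12 => *; apply/andP; split; lra. Qed.

Lemma fc_density_nincr : {in `]0, 4] &, {homo fc_density r : x y /~ x <= y}}.
Proof.
have dle x : x \in `]0, 4[%R -> 0 < x < 4 by rewrite in_itv.
apply: ler0_derive1_le_oc.
- by move=> x /dle x04; have [] := is_derive_fc_density r x04.
- move=> x /dle x04; rewrite derive1E;
  have [_ ->] := is_derive_fc_density r x04.
  have /andP[x0 x4] := x04.
  rewrite oppr_le0 mulr_ge0 //;
    first by rewrite divr_ge0 ?powR_ge0 // mulr_ge0 ?sqrtr_ge0 ?(ltW x0).
  by apply: ltW; apply: mode_inequality => //; exact: fc_angle_itv.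
- apply: (@within_continuous_gt0 R) => [x /=|x];
  last exact: continuous_fc_density.
  by rewrite !in_itv /= andbT => /andP[].
Qed.

(* In fact fc_mass = pi, but only its positivity matters: it is determined by
   the normalisation of mu(2, r). *)
Definition fc_mass : R := fine (fc_moment r `]0, 4] 0).

(** Both sides obey the same first-order recurrence with nonzero leading coefficient, and they agree
    at k = 0. *)
Lemma fc_momentE k :
  fc_moment r `]0, 4] k = (fc_mass * fuss_catalan_number 2 r k)%:E.
Proof.
have r0 : 0 < r by case/andP: r02.
elim: k => [|k IH]; first by rewrite mulr1 fineK // fc_moment_fin_num.
have fin := fc_moment_fin_num r02.
have k0 : 0 <= k%:R :> R by [].
have := fc_moment_recurrence r02 k;
  rewrite IH -(fineK (fin k.+1)) -!EFinM => -[] e.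
congr EFin; apply: (@mulfI _ ((k%:R + 1) * (k%:R + 1 + r))).
  by rewrite mulf_neq0 // gt_eqF //; lra.
rewrite e [RHS]mulrCA fuss_catalan2_recurrence //; ring.
Qed.

(** By monotonicity the density is at least its value at 2, which is positive, on all of ]0, 2]. *)
Lemma fc_mass_gt0 : 0 < fc_mass.
Proof.
have q2 : 0 < fc_density r 2 by apply: fc_density_gt0 => //; apply/andP; split;
  lra.
rewrite -lte_fin /fc_mass fineK; last exact: fc_moment_fin_num.
have lower : (0 < \int[leb]_(x in `]0%R, 2%R]) cst (fc_density r 2)%:E x)%E.
  rewrite integral_cst //= lebesgue_measure_itv /= lte_fin ltr0n /=.
  by rewrite -EFinB -EFinM lte_fin mulr_gt0 //; lra.
apply: (lt_le_trans lower); apply: (@le_trans _ _ (fc_moment r `]0, 2] 0)).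
  apply: ge0_le_integral => //.
  - by move=> x _; rewrite lee_fin ltW.
  - apply/measurable_EFinP; apply: measurable_moment_density => // x /=.
    by rewrite !in_itv /= andbT => /andP[].
  - move=> x /=; rewrite in_itv /= => /andP[x0 x2].
    rewrite lee_fin expr0 mul1r; apply: fc_density_nincr => //;
      rewrite in_itv /=;
    by apply/andP; split; lra.
apply: ge0_subset_integral => //.
- apply/measurable_EFinP; apply: measurable_moment_density => // x /=.
  by rewrite !in_itv /= andbT => /andP[].
- by move=> x /=; rewrite in_itv /=; exact: moment_density_ge0.
- by apply: subset_itvl; rewrite bnd_simp; lra.
Qed.

End density_monotonicity.

(** * Polynomials converging pointwise to a step function *)

Section step_approximation.
Context {R : realType}.
Implicit Types v y z : R.

Lemma cvg_natmul_expr z : 0 <= z < 1 -> (n%:R * z ^+ n) @[n --> \oo] -->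
  (0 : R).
Proof.
move=> /andP[z0 z1]; set s := Num.sqrt z.
have s0 : 0 <= s by exact: sqrtr_ge0.
have s1 : s < 1 by rewrite -sqrtr1 ltr_sqrt.
have zE : z = s ^+ 2 by rewrite sqr_sqrtr.
(* Each of the n terms of 1 + s + ... + s^(n-1) is at least s^n. With z = s^2 this gives n z^n <=
   s^n / (1 - s). *)
have bound n : n%:R * s ^+ n * (1 - s) <= 1 - s ^+ n.
  elim: n => [|n IH]; first by rewrite !mul0r expr0 subrr.
  have sn1 : s ^+ n <= 1 by rewrite exprn_ile1 // ltW.
  have sn0 : 0 <= s ^+ n by rewrite exprn_ge0.
  rewrite -natr1 exprS; move: IH sn0 sn1; move: (s ^+ n) (n%:R) => p m IH p0 p1.
  have := ler_wpM2l s0 IH.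
  have : 0 <= (1 - s) * (1 - s * p) by rewrite mulr_ge0 //; nra.
  by nra.
have cs : s ^+ n / (1 - s) @[n --> \oo] --> (0 : R).
  rewrite -(mul0r (1 - s)^-1); apply: cvgM; last exact: cvg_cst.
  by apply: cvg_expr; rewrite ger0_norm.
apply: squeeze_cvgr (cvg_cst 0) cs; apply: nearW => n.
have sn0 : 0 <= s ^+ n by rewrite exprn_ge0.
rewrite mulr_ge0 ?exprn_ge0 //= ler_pdivlMr ?subr_gt0 // zE -exprM mulnC exprM
  expr2.
have := bound n; rewrite mulrAC; nra.
Qed.

Lemma bernoulli_ge y n : 0 <= y <= 1 -> 1 - n%:R * y <= (1 - y) ^+ n.
Proof.
move=> /andP[y0 y1]; elim: n => [|n IH]; first by rewrite mul0r subr0 expr0.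
have n0 : 0 <= n%:R :> R by [].
by rewrite exprS -natr1; apply: le_trans (ler_wpM2l _ IH); [nra|lra].
Qed.

Lemma bernoulli_le y n : 0 <= y <= 1 -> (1 - y) ^+ n * (1 + n%:R * y) <= 1.
Proof.
move=> /andP[y0 y1]; elim: n => [|n IH]; first by rewrite mul0r addr0 mulr1.
have n0 : 0 <= n%:R :> R by [].
have p0 : 0 <= (1 - y) ^+ n by rewrite exprn_ge0 //; lra.
rewrite exprSr -natr1; apply: le_trans IH; rewrite -mulrA ler_wpM2l //; nra.
Qed.

(* The exponent is chosen so that N v^n, with N = n 2^n, tends to 0 for v < 1/2
   and to infinity for v >= 1/2, including the threshold. *)
Definition step_poly n : {poly R} := (1 - 'X ^+ n) ^+ (n * 2 ^ n).

Lemma step_polyE n v : (step_poly n).[v] = (1 - v ^+ n) ^+ (n * 2 ^ n).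
Proof. by rewrite /step_poly horner_exp !hornerE. Qed.

Lemma step_poly_itv n v : 0 <= v <= 1 -> 0 <= (step_poly n).[v] <= 1.
Proof.
move=> /andP[v0 v1]; have v01 : 0 <= v ^+ n <= 1
  by rewrite exprn_ge0 ?exprn_ile1.
by rewrite step_polyE exprn_ge0 ?exprn_ile1 //; lra.
Qed.

(** With N the outer exponent, N v^n = n (2v)^n. Below 1/2 this tends to 0 and Bernoulli bounds the
    value from below by 1 - N v^n; otherwise it is at least n and the value is at most 1/(n+1). *)
Lemma cvg_step_poly v : 0 <= v <= 1 ->
  (step_poly n).[v] @[n --> \oo] --> (if v < 1 / 2 then 1 else 0 : R).
Proof.
move=> v01; have /andP[v0 v1] := v01.
have vn01 n : 0 <= v ^+ n <= 1 by rewrite exprn_ge0 ?exprn_ile1.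
have e n : (n * 2 ^ n)%:R * v ^+ n = n%:R * (2 * v) ^+ n.
  by rewrite natrM natrX -mulrA -exprMn.
have [v12|v12] := ltP v (1 / 2).
- have c : (1 - n%:R * (2 * v) ^+ n) @[n --> \oo] --> (1 : R).
    rewrite -[X in _ --> X](subr0 (1 : R)); apply: cvgB; first exact: cvg_cst.
    by apply: cvg_natmul_expr; lra.
  apply: squeeze_cvgr c (cvg_cst (1 : R)); apply: nearW => n.
  have /andP[_ ->] := step_poly_itv n v01.
  by rewrite step_polyE -e bernoulli_ge.
- apply: squeeze_cvgr (cvg_cst 0) (@cvg_harmonic R); apply: nearW => n.
  have /andP[-> _] /= := step_poly_itv n v01.
  rewrite step_polyE /harmonic -[leRHS]mul1r ler_pdivlMr ?ltr0n //.
  apply: le_trans (bernoulli_le (n * 2 ^ n) (vn01 n)).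
  rewrite ler_wpM2l ?exprn_ge0 //; first by have := vn01 n; lra.
  rewrite e -natr1 addrC lerD2l ler_peMr // exprn_ege1 //; lra.
Qed.

End step_approximation.

(** * Measures given by a density *)

Section weighted_measure.
Context d (T : measurableType d) (R : realType).
Variables (m : {measure set T -> \bar R}) (w : T -> R).
Hypothesis w0 : forall x, 0 <= w x.
Hypothesis mw : measurable_fun setT w.

(** The two proofs are arguments so that the measure instance can be attached to the term itself. *)
Definition weighted_measure of (forall x, 0 <= w x) & measurable_fun setT w :=
  fun A : set T => (\int[m]_(x in A) (w x)%:E)%E.

Local Notation nu := (weighted_measure w0 mw).

Let nu0 : nu set0 = 0%E. Proof. exact: integral_set0. Qed.

Let nu_ge0 A : (0 <= nu A)%E.
Proof. by apply: integral_ge0 => x _; rewrite lee_fin. Qed.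

Let nu_sigma_additive : semi_sigma_additive nu.
Proof.
apply: semi_sigma_additive_nng_induced; first exact/measurable_EFinP.
by move=> x; rewrite lee_fin.
Qed.

HB.instance Definition _ := isMeasure.Build d T R nu nu0 nu_ge0
  nu_sigma_additive.

End weighted_measure.

(** * Compactly supported weights are determined by their moments *)

Section moment_determinacy.
Context {R : realType}.
Local Notation T := (measurableTypeR R).

Section weight.
Variables (m : {measure set T -> \bar R}) (w : R -> R) (b : R).
Hypothesis wb : forall x, b < `|x| -> w x = 0.
Hypothesis iw : m.-integrable setT (EFin \o w).

Let mw : measurable_fun setT w.
Proof. by have /integrableP[/measurable_EFinP] := iw. Qed.

(** A continuous [g] is bounded on the compact [-b, b], and [w] vanishes outside it. *)
Lemma integrable_mul_weight (g : R -> R) : continuous g ->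
  m.-integrable setT (EFin \o (fun x => g x * w x)).
Proof.
move=> cg.
have [c cP] : exists c, forall x, `|x| <= b -> `|g x| <= c.
  have : bounded_set (g @` `[- b, b]).
    apply: compact_bounded; apply: continuous_compact;
      last exact: segment_compact.
    exact: continuous_subspaceT.
  case=> M [_ HM]; exists (M + 1) => x xb; apply: HM; first by rewrite ltrDl.
  by exists x => //=; rewrite in_itv /= -ler_norml.
apply: (@le_integrable _ T R m setT measurableT _ (fun x => c%:E * (w x)%:E)%E).
- by apply/measurable_EFinP; apply: measurable_funM => //;
  exact: continuous_measurable_fun.
- move=> x _; rewrite -EFinM !abse_EFin lee_fin !normrM.
  have [xb|bx] := leP `|x| b; last by rewrite wb // normr0 !mulr0.
  by rewrite ler_wpM2r // (le_trans (cP x xb)) // ler_norm.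
- exact: integrableZl.
Qed.

End weight.

Variables (m1 m2 : {measure set T -> \bar R}) (w1 w2 : R -> R) (b : R).
Hypothesis b0 : 0 < b.
Hypothesis w1_ge0 : forall x, 0 <= w1 x.
Hypothesis w2_ge0 : forall x, 0 <= w2 x.
Hypothesis w1b : forall x, b < `|x| -> w1 x = 0.
Hypothesis w2b : forall x, b < `|x| -> w2 x = 0.
Hypothesis iw1 : m1.-integrable setT (EFin \o w1).
Hypothesis iw2 : m2.-integrable setT (EFin \o w2).
Hypothesis moments : forall k,
  (\int[m1]_x (x ^+ k * w1 x)%:E = \int[m2]_x (x ^+ k * w2 x)%:E)%E.

Lemma poly_moments (p : {poly R}) :
  (\int[m1]_x (p.[x] * w1 x)%:E = \int[m2]_x (p.[x] * w2 x)%:E)%E.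
Proof.
(* The extra power makes the induction go through: peeling p * X + c moves the X into it. *)
suff H k : (\int[m1]_x (p.[x] * x ^+ k * w1 x)%:E =
            \int[m2]_x (p.[x] * x ^+ k * w2 x)%:E)%E.
  have := H 0%N; under eq_integral do rewrite expr0 mulr1.
  by under [in X in _ = X -> _]eq_integral do rewrite expr0 mulr1.
elim/poly_ind: p k => [|p c IH] k.
  by rewrite !integral0_eq // => x _; rewrite horner0 !mul0r.
have split (m : {measure set T -> \bar R}) (w : R -> R) :
    (forall x, b < `|x| -> w x = 0) -> m.-integrable setT (EFin \o w) ->
  (\int[m]_x ((p * 'X + c%:P).[x] * x ^+ k * w x)%:E =
   \int[m]_x (p.[x] * x ^+ k.+1 * w x)%:E + c%:E * \int[m]_x (x ^+ k * w
     x)%:E)%E.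
  move=> wb iw.
  have i1 := integrable_mul_weight wb iw (g := fun x => p.[x] * x ^+ k.+1).
  have i2 := integrable_mul_weight wb iw (g := fun x => x ^+ k).
  rewrite -integralZl //; last by apply: i2; exact: exprn_continuous.
  rewrite -integralD //=.
  - apply: eq_integral => x _; rewrite -EFinM -EFinD hornerMXaddC exprS.
    by congr EFin; ring.
  - apply: i1 => x; apply: cvgM; first exact: continuous_horner.
    exact: exprn_continuous.
  - by apply: integrableZl => //; apply: i2; exact: exprn_continuous.
by rewrite !split // IH moments.
Qed.

(* Maps [-b, b] into [0, 1] and t to 1/2. *)
Definition step_shift (t : R) : {poly R} :=
  (2 * (b + `|t|))^-1 *: 'X + (1 / 2 - t / (2 * (b + `|t|)))%:P.

(** Dominated convergence with dominating function [w]: on [-b, b] the composed polynomials take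
    values in [0, 1] and converge to the indicator of x < t. *)
Lemma cvg_integral_step (t : R) (m : {measure set T -> \bar R}) (w : R -> R) :
  (forall x, 0 <= w x) ->
  (forall x, b < `|x| -> w x = 0) -> m.-integrable setT (EFin \o w) ->
  (\int[m]_x ((step_poly n \Po step_shift t).[x] * w x)%:E @[n --> \oo] -->
   \int[m]_(x in `]-oo, t[) (w x)%:E)%E.
Proof.
move=> w0 wb iw; set u := step_shift t; set L := b + `|t|.
have L0 : 0 < L by rewrite ltr_pwDl.
have uE x : u.[x] = 1 / 2 + (x - t) / (2 * L).
  by rewrite /u /step_shift hornerD hornerZ hornerX hornerC -/L; field;
    rewrite gt_eqF.
have u01 x : `|x| <= b -> 0 <= u.[x] <= 1.
  move=> xb; have : `|x - t| <= L
    by rewrite (le_trans (ler_normB _ _)) // lerD2r.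
  rewrite ler_norml uE => /andP[h1 h2].
  have -> : 1 / 2 + (x - t) / (2 * L) = (L + (x - t)) / (2 * L).
    by field; rewrite gt_eqF.
  by rewrite divr_ge0 ?mulr_ge0 ?ler_pdivrMr ?mulr_gt0 //=; lra.
have ult x : (u.[x] < 1 / 2) = (x < t).
  by rewrite uE -ltrBrDl subrr pmulr_llt0 ?invr_gt0 ?mulr_gt0 // subr_lt0.
have mw : measurable_fun setT w by have /integrableP[/measurable_EFinP] := iw.
pose g x := (if x < t then 1 else 0) * w x.
have gE : (\int[m]_(x in `]-oo, t[) (w x)%:E = \int[m]_x (g x)%:E)%E.
  rewrite integral_mkcond; apply: eq_integral => x _.
  rewrite patchE mem_setE in_itv /= /g.
  by case: ifP => _; rewrite ?mul1r ?mul0r.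
have mg : measurable_fun setT g.
  apply: measurable_funM => //; apply: measurable_fun_ifT => //.
  exact: measurable_fun_ltr.
rewrite gE.
pose f n x := (step_poly n \Po u).[x] * w x.
have mf n : measurable_fun (setT : set T) (EFin \o f n).
  apply/measurable_EFinP; apply: measurable_funM => //.
  by apply: continuous_measurable_fun; exact: continuous_horner.
have cf : {ae m, forall x, setT x -> (EFin \o f n) x @[n --> \oo] -->
  (EFin \o g) x}.
  apply: aeW => x _; have [xb|bx] := leP `|x| b; last first.
    by rewrite /f /g /= wb // mulr0; apply: cvg_near_cst; apply: nearW => n;
      rewrite mulr0.
  apply: cvg_EFin; first exact: nearW.
  have c : (step_poly n \Po u).[x] @[n --> \oo] -->
    (if x < t then 1 else 0 : R).
    rewrite -ult; under eq_fun do rewrite horner_comp.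
    by apply: cvg_step_poly; exact: u01.
  exact: (cvgM c (cvg_cst (w x))).
have le_f : {ae m, forall x n, setT x -> (`|(EFin \o f n) x| <= (EFin \o w)
  x)%E}.
  apply: aeW => x n _; rewrite /f /= lee_fin normrM (ger0_norm (w0 x)).
  have [xb|bx] := leP `|x| b; last by rewrite wb // mulr0.
  rewrite horner_comp -[leRHS]mul1r ler_wpM2r //.
  by have /andP[h0 h1] := step_poly_itv n (u01 x xb); rewrite ger0_norm.
have mEg : measurable_fun (setT : set T) (EFin \o g) by exact/measurable_EFinP.
by have [] := dominated_convergence measurableT mf mEg cf iw le_f.
Qed.

(** Step polynomials have equal integrals on both sides, so in the limit the two weighted measures
    agree on the open half-lines ]-oo, t[. These are stable under intersection and generate the
    Borel sets. *)
Lemma moment_determinacy (A : set T) : measurable A ->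
  (\int[m1]_(x in A) (w1 x)%:E = \int[m2]_(x in A) (w2 x)%:E)%E.
Proof.
have mw (m : {measure set T -> \bar R}) (w : R -> R) :
    m.-integrable setT (EFin \o w) -> measurable_fun (setT : set T) w.
  by move=> /integrableP[/measurable_EFinP].
move=> mA.
pose n1 : {measure set T -> \bar R} := weighted_measure m1 w1_ge0 (mw _ _ iw1).
pose n2 : {measure set T -> \bar R} := weighted_measure m2 w2_ge0 (mw _ _ iw2).
rewrite -[LHS]/(n1 A) -[RHS]/(n2 A).
have mG : @measurable _ (T : measurableType _) = <<s @RGenInftyO.G R >>.
  exact: RGenInftyO.measurableE.
have IG : setI_closed (@RGenInftyO.G R).
  move=> _ _ [x ->] [y ->]; exists (Order.min x y).
  apply/seteqP; split => z /=; rewrite !in_itv /= lt_min.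
    by move=> [-> ->].
  by move=> /andP[].
have Gg n : @RGenInftyO.G R `]-oo, n%:R[%classic by exists n%:R.
have gT : \bigcup_n `]-oo, n%:R[%classic = [set: R].
  apply/seteqP; split => // x _; exists (Num.truncn `|x|).+1 => //=.
  by rewrite in_itv /= (le_lt_trans (ler_norm x)) // truncnS_gt.
have U := measure_unique _ _ mG IG Gg gT n1 n2. apply: U => //.
- move=> _ [t ->].
  have c1 := @cvg_integral_step t m1 w1 w1_ge0 w1b iw1.
  have c2 := @cvg_integral_step t m2 w2 w2_ge0 w2b iw2.
  have E : (fun n => \int[m1]_x ((step_poly n \Po step_shift t).[x] * w1
    x)%:E)%E =
           (fun n => \int[m2]_x ((step_poly n \Po step_shift t).[x] * w2
             x)%:E)%E.
    by apply/funext => n; exact: poly_moments.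
  by rewrite /= E in c1; exact: (cvg_unique _ c1 c2).
- move=> n.
  have mI : measurable (`]-oo, n%:R[%classic : set T) by exact: measurable_itv.
  apply: integrable_lty => //.
  by have := integrableS measurableT mI (@subsetT _ _) iw1.
Qed.

End moment_determinacy.

(** * Identification of the law and its unimodality *)

Section unimodality.
Context {R : realType}.
Local Notation T := (measurableTypeR R).
Notation leb := (@lebesgue_measure R).
Variable r : R.
Hypothesis r12 : 1 < r < 2.
Hypothesis gap_lt0 : mode_gap r < 0.

Let M0 := fc_mass_gt0 r12 gap_lt0.
Let r02 : 0 < r < 2. Proof. by case/andP: r12 => *; apply/andP; split; lra. Qed.

Definition fc_pdf (x : R) : R := if 0 < x <= 4 then fc_density r x / fc_mass r
  else 0.

Lemma fc_pdf_ge0 x : 0 <= fc_pdf x.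
Proof.
rewrite /fc_pdf; case: ifP => // x04.
by rewrite divr_ge0 ?(ltW M0) // fc_density_ge0.
Qed.

Lemma fc_pdf_nincr : {in `]0, +oo[ &, {homo fc_pdf : x y /~ x <= y}}.
Proof.
move=> x y; rewrite !in_itv /= !andbT => x0 y0 yx.
rewrite /fc_pdf x0 y0 /=; have [x4|x4] := leP x 4; last first.
  by case: ifP => // y4; rewrite divr_ge0 ?(ltW M0) // fc_density_ge0 // y0.
rewrite (le_trans yx x4) ler_pM2r ?invr_gt0 //.
by apply: fc_density_nincr => //; rewrite in_itv /= ?x0 ?y0 // (le_trans yx x4).
Qed.

Let pdfE k : (fun x => (x ^+ k * fc_pdf x)%:E) =
  (fun x => (fc_mass r)^-1%:E * (x ^+ k * fc_density r x)%:E)%E \_ `]0, 4].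
Proof.
apply/funext => x; rewrite patchE mem_setE in_itv /= /fc_pdf.
by case: ifP => _; rewrite ?mulr0 // -EFinM; congr EFin; ring.
Qed.

Let measurable_q k : measurable_fun (`]0, 4]%classic : set T)
  (fun x : R => (x ^+ k * fc_density r x)%:E).
Proof.
apply/measurable_EFinP; apply: measurable_moment_density => // x /=.
by rewrite !in_itv /= andbT => /andP[].
Qed.

Lemma fc_pdf_moment k :
  (\int[leb]_x (x ^+ k * fc_pdf x)%:E = (fuss_catalan_number 2 r k)%:E)%E.
Proof.
rewrite pdfE -integral_mkcond ge0_integralZl //.
- rewrite -/(fc_moment r `]0, 4] k) fc_momentE // -EFinM mulrA mulVf ?mul1r //.
  by rewrite gt_eqF.
- by move=> x /=; rewrite in_itv /=; exact: moment_density_ge0.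
- by rewrite lee_fin invr_ge0 ltW.
Qed.

Lemma integrable_fc_pdf : leb.-integrable setT (EFin \o fc_pdf).
Proof.
have -> : EFin \o fc_pdf = (fun x => (x ^+ 0 * fc_pdf x)%:E).
  by apply/funext => x; rewrite mul1r.
have mD : measurable (`]0, 4]%classic : set T) by exact: measurable_itv.
rewrite pdfE; apply: (integrable_mkcond _ mD).1.
apply: (integrableZl mD); apply/integrableP; split => //.
under eq_integral.
  move=> x /set_mem x04; rewrite gee0_abs; last first.
    by apply: moment_density_ge0; rewrite /= in_itv /= in x04.
  over.
by rewrite -/(fc_moment r `]0, 4] 0) ltey_eq fc_moment_fin_num.
Qed.

Lemma fuss_catalan2_pdf (mu : probability T R) : is_fuss_catalan 2 r mu ->
  forall A : set T, measurable A -> mu A = (\int[leb]_(x in A) (fc_pdf x)%:E)%E.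
Proof.
move=> [[K cK muK] moments] A mA.
(* One radius has to serve for both weights: [-b, b] contains [K] as well as the interval ]0, 4]
   carrying [fc_pdf]. *)
have [b b4 Kb] : exists2 b : R, 4 <= b & forall x, K x -> `|x| <= b.
  have [M [_ HM]] := compact_bounded cK.
  exists (Num.max 4 (M + 1)); first by rewrite le_max lexx.
  by move=> x Kx; rewrite le_max (HM (M + 1)) ?orbT // ltrDl.
have b0 : 0 < b by apply: lt_le_trans b4.
(* The cut-off indicator puts [mu] in weighted form; it equals 1 almost everywhere for [mu], so no
   integral changes. *)
pose w1 : R -> R := \1_(`[- b, b] : set R).
have mw1 : measurable_fun (setT : set T) w1.
  by apply: measurable_indic; exact: measurable_itv.
have w1_ge0 x : 0 <= w1 x by rewrite /w1 indicE.
have w1E x : w1 x = (`|x| <= b)%R%:R.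
  by rewrite /w1 indicE mem_setE in_itv /= ler_norml.
have w1b x : b < `|x| -> w1 x = 0 by rewrite w1E leNgt => ->.
have w2b x : b < `|x| -> fc_pdf x = 0.
  move=> bx; rewrite /fc_pdf; case: ifP => // /andP[x0 x4].
  by move: bx; rewrite gtr0_norm // => ?; lra.
have mK : measurable (~` K : set T).
  by apply: measurableC; exact: compact_measurable.
have ae1 (g : R -> R) : ae_eq mu setT (fun x => (g x * w1 x)%:E) (fun x =>
  (g x)%:E).
  exists (~` K); split => // x /= h Kx; apply: h => _.
  by rewrite w1E Kb // mulr1.
have iw1 : mu.-integrable setT (EFin \o w1).
  have mI : measurable (`[- b, b]%classic : set T) by exact: measurable_itv.
  exact: (integrable_indic mu mI).
have mX k : measurable_fun (setT : set T) (fun x : R => x ^+ k).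
  by apply: continuous_measurable_fun; exact: exprn_continuous.
have := @moment_determinacy R mu leb w1 fc_pdf b b0 w1_ge0 fc_pdf_ge0 w1b w2b
  iw1
  integrable_fc_pdf _ A mA.
move=> <-; last first.
  move=> k; rewrite fc_pdf_moment -moments; apply: ae_eq_integral => //.
  - by apply/measurable_EFinP; exact: measurable_funM.
  - exact/measurable_EFinP.
transitivity (\int[mu]_(x in A) (cst 1%:E) x)%E.
  by rewrite integral_cst // mul1e.
apply: ae_eq_integral => //.
- by apply/measurable_EFinP; exact: measurable_funTS.
- apply: ae_eq_subset (@subsetT _ A) _.
  have := ae1 (cst 1); apply: filterS => x h _.
  by rewrite -h // mul1r.
Qed.

Lemma fuss_catalan2_unimodal (mu : probability T R) :
  is_fuss_catalan 2 r mu -> unimodal mu.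
Proof.
(* The mode is 0, without an atom; to its left the density is identically 0. *)
move=> fc; exists 0, 0, fc_pdf; split => //.
- exact: fc_pdf_ge0.
- move=> x y; rewrite !in_itv /= => x0 y0 _.
  by rewrite /fc_pdf !ltNge (ltW x0) (ltW y0).
- exact: fc_pdf_nincr.
- by move=> A mA; rewrite mul0e add0e; exact: fuss_catalan2_pdf.
Qed.

End unimodality.

Theorem proposition4p9 (R : realType) :
  exists r0 : R,
    unique (fun r : R =>
      3 / 2 < r < 2 /\
      r * sin ((3 * r + 3) / (2 * r + 4) * pi)
        + 2 * sin (3 * r / (2 * r + 4) * pi) * cos (3 / (2 * r + 4) * pi) = 0)
      r0 /\
    forall r : R, 1 < r < r0 ->
      forall mu : probability (measurableTypeR R) R,
        is_fuss_catalan 2 r mu -> unimodal mu.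
Proof.
have [r0 [r0_itv r0_root]] := @mode_gap_root R.
have r0_gt := r0_itv; move/andP: r0_gt => [r0_gt r0_lt].
(* On this interval cos t > 0, so the equation has the same roots as [mode_gap], whose strict
   monotonicity gives uniqueness. *)
have eq_mode (r : R) : 3 / 2 < r < 2 ->
  (r * sin ((3 * r + 3) / (2 * r + 4) * pi)
     + 2 * sin (3 * r / (2 * r + 4) * pi) * cos (3 / (2 * r + 4) * pi) = 0)
  <-> mode_gap r = 0.
  move=> /andP[r1 r2]; rewrite mode_equation; last by lra.
  have c0 : 0 < cos (mode_angle r) by apply: cos_mode_angle_gt0; apply/andP;
    split; lra.
  split => [/eqP|->]; last by rewrite mulr0.
  by rewrite mulf_eq0 oppr_eq0 gt_eqF //= => /eqP.
exists r0; split.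
  split; first by split => //; apply/eq_mode.
  move=> r [r_itv /(eq_mode _ r_itv) r_root].
  have /andP[r1 r2] := r_itv.
  have [rr0|rr0|//] := ltgtP r0 r.
  - have := @mode_gap_increasing R r0 r ltac:(lra) rr0 (ltW r2).
    by rewrite r0_root r_root ltxx.
  - have := @mode_gap_increasing R r r0 ltac:(lra) rr0 (ltW r0_lt).
    by rewrite r0_root r_root ltxx.
move=> r /andP[r1 rr0] mu.
(* Monotonicity turns r < r0 into [mode_gap r < mode_gap r0 = 0], the hypothesis required for
   unimodality. *)
apply: fuss_catalan2_unimodal; first by apply/andP; split; lra.
by rewrite -r0_root; apply: mode_gap_increasing => //; lra.
Qed.
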